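(* Let $n\ge 1$ and let $X$ be a topological space such that $\pi_n^{top}(X,x)$ is discrete for every $x\in X$. Then $X$ is $n$-semilocally simply connected.
   Context: For a pointed space $(X,x)$ and $n\ge 1$, let $I=[0,1]$, let $\dot{I}^n$ be the boundary of $I^n$, and let $\mathrm{Hom}((I^n,\dot{I}^n),(X,x))$ be the set of continuous maps $f:I^n\to X$ with $f(\dot{I}^n)\subseteq\{x\}$ ($n$-loops at $x$), equipped with the compact-open topology, i.e. the topology with subbase the sets $\langle K,U\rangle=\{f : f(K)\subseteq U\}$, $K\subseteq I^n$ compact, $U\subseteq X$ open. Let $p_n:\mathrm{Hom}((I^n,\dot{I}^n),(X,x))\to\pi_n(X,x)$ be the surjection sending a map to its homotopy class relative to $\dot{I}^n$. $\pi_n^{top}(X,x)$ denotes the homotopy group $\pi_n(X,x)$ equipped with the quotient topology induced by $p_n$. A topological space $X$ is called $n$-semilocally simply connected if for each $x\in X$ there exists an open neighborhood $U$ of $x$ for which any $n$-loop in $U$ (at $x$) is nullhomotopic in $X$; in other words, the homomorphism $i_*:\pi_n(U,x)\to\pi_n(X,x)$ induced by the inclusion is zero (trivial). *)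

(* Defs.v *)
From HB Require Import structures.
From mathcomp Require Import all_boot all_order all_algebra generic_quotient.
From mathcomp Require Import all_classical all_reals all_analysis.

Set Implicit Arguments.
Unset Strict Implicit.
Unset Printing Implicit Defensive.

Import Order.TTheory GRing.Theory Num.Theory.
Import numFieldNormedType.Exports.

Local Open Scope classical_set_scope.
Local Open Scope ring_scope.
Local Open Scope quotient_scope.

Definition cube (R : realType) (n : nat) : set 'rV[R]_n :=
  [set t | forall i, 0 <= t ord0 i <= 1].
Arguments cube : clear implicits.

(* The boundary is taken in 'rV[R]_n; see cube_boundaryE for the usual
   description by coordinates. *)
Definition cube_boundary (R : realType) (n : nat) : set 'rV[R]_n :=
  closure (cube R n) `\` (cube R n)°.
Arguments cube_boundary : clear implicits.

Definition unit_interval (R : realType) : set R := `[0, 1].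
Arguments unit_interval : clear implicits.

Section boundary.
Context {R : realType} {n : nat}.

Lemma closed_cube : closed (cube R n).
Proof.
have -> : cube R n = \bigcap_(i in [set: 'I_n])
    ((fun t : 'rV[R]_n => t ord0 i) @^-1` `[0, 1]).
  apply/seteqP; split => [t ht i _|t ht i] /=; first by rewrite in_itv /= ht.
  by have := ht i I; rewrite /= in_itv.
apply: closed_bigI => i _.
have /continuous_closedP := @coord_continuous R 1 n ord0 i.
by apply; exact: itv_closed.
Qed.

Lemma cube_boundaryE : cube_boundary R n =
  cube R n `&` [set t | exists i, t ord0 i = 0 \/ t ord0 i = 1].
Proof.
rewrite /cube_boundary -(closure_id _).1; last exact: closed_cube.
apply/seteqP; split => t [ct ht]; split=> //.
  apply: contrapT => /forallNP no; apply: ht.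
  have pos i : 0 < t ord0 i < 1.
    have /andP[t0 t1] := ct i; have /not_orP[n0 n1] := no i.
    by rewrite !lt_neqAle t0 t1 (eq_sym 0) !andbT; apply/andP; split; apply/eqP.
  exists (fun _ j => `]0, 1[%classic) => [i j|u hu i].
    rewrite (ord1 i); apply: open_nbhs_nbhs; split; first exact: itv_open.
    by rewrite /= in_itv /= pos.
  by have := hu ord0 i; rewrite /= in_itv /= => /andP[? ?]; rewrite !ltW.
move=> [P Pt sPC]; case: ht => i hi.
have /nbhs_ballP[e /= e0 be] := Pt ord0 i.
pose d : R := if t ord0 i == 0 then - (e / 2) else e / 2.
pose u : 'rV[R]_n := \row_j (if j == i then t ord0 i + d else t ord0 j).
have e20 : 0 < e / 2 by rewrite divr_gt0.
have : cube R n u.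
  apply: sPC => k j; rewrite (ord1 k) mxE; case: eqP => [->|_]; last first.
    exact: nbhs_singleton.
  apply: be; rewrite /ball /= opprD addNKr normrN /d; case: ifP => _;
    by rewrite ?normrN gtr0_norm// gtr_pMr// invf_lt1// ltr1n.
move=> /(_ i); rewrite mxE eqxx; apply/negP; rewrite /d.
move: (t ord0 i) hi => r -[] ->.
  by rewrite eqxx add0r oppr_ge0 (lt_geF e20).
by rewrite oner_eq0 gerDl (lt_geF e20) andbF.
Qed.

End boundary.

(* An n-loop at x lives on the subtype of points of the cube, whose topology
   is the subspace topology of R^n. *)
Definition is_nloop (R : realType) (n : nat) (X : topologicalType) (x : X) :
    set (continuousType (cube R n) X) :=
  [set f | forall t : cube R n, cube_boundary R n (sval t) -> f t = x].

Definition nloop (R : realType) (n : nat) (X : topologicalType) (x : X) : Type :=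
  set_type (is_nloop (R := R) (n := n) x).
Arguments nloop : clear implicits.
Arguments nloop R n {X} x.

Definition nloop_fun (R : realType) (n : nat) (X : topologicalType) (x : X)
  (f : nloop R n x) : cube R n -> X := val f.

Coercion nloop_fun : nloop >-> Funclass.

HB.instance Definition _ (R : realType) (n : nat) (X : topologicalType)
    (x : X) :=
  Choice.copy (nloop R n x) (set_type (is_nloop (R := R) (n := n) x)).
HB.instance Definition _ (R : realType) (n : nat) (X : topologicalType)
    (x : X) :=
  Topological.copy (nloop R n x)
    (initial_topology
       (@nloop_fun R n X x : nloop R n x -> {compact-open, cube R n -> X})).

Lemma is_nloop_cst (R : realType) (n : nat) (X : topologicalType) (x : X) :
  is_nloop x (cst x : continuousType (cube R n) X).
Proof. by []. Qed.

Definition cst_nloop (R : realType) (n : nat) (X : topologicalType) (x : X) :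
    nloop R n x :=
  exist (fun f => f \in is_nloop x) (cst x)
    (mem_set (@is_nloop_cst R n X x)).

Definition homotopic (R : realType) (n : nat) (X : topologicalType) (x : X)
    (f g : nloop R n x) : Prop :=
  exists H : (cube R n * unit_interval R)%type -> X,
    [/\ continuous H,
        forall t s, sval s = 0 -> H (t, s) = f t,
        forall t s, sval s = 1 -> H (t, s) = g t &
        forall t s, cube_boundary R n (sval t) -> H (t, s) = x].

Section homotopy_equivalence.
Context {R : realType} {n : nat} {X : topologicalType} {x : X}.
Implicit Types f g h : nloop R n x.

Lemma nloop_continuous f : continuous f.
Proof. exact: cts_fun. Qed.

Lemma nloop_boundary f (t : cube R n) : cube_boundary R n (sval t) -> f t = x.
Proof. by have /set_mem := valP f; exact. Qed.

Lemma homotopic_refl f : homotopic f f.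
Proof.
exists (fun p => f p.1); split=> // [|t s bt]; last exact: nloop_boundary.
by move=> p; apply: continuous_comp; [exact: cvg_fst|exact: nloop_continuous].
Qed.

Lemma clamp_proof (r : R) : unit_interval R (Num.max 0 (Num.min r 1)).
Proof.
by rewrite /unit_interval /= in_itv /= le_max lexx ge_max ler01 ge_min lexx orbT.
Qed.

Definition clamp (r : R) : unit_interval R :=
  exist (fun s => s \in unit_interval R) _ (mem_set (clamp_proof r)).

Lemma clamp_id (r : R) : 0 <= r <= 1 -> sval (clamp r) = r.
Proof. by move=> /andP[r0 r1] /=; rewrite (min_idPl r1) (max_idPr r0). Qed.

Lemma val_unit (s : unit_interval R) : 0 <= sval s <= 1.
Proof. by have /set_mem := valP s; rewrite /unit_interval /= in_itv. Qed.

Lemma clamp_continuous : continuous clamp.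
Proof.
apply: continuous_comp_initial => r.
apply: (@continuous_max _ _ (cst 0) (fun r : R => Num.min r 1)).
  exact: cst_continuous.
apply: (@continuous_min _ _ id (cst 1)); [exact: cvg_id|exact: cst_continuous].
Qed.

Definition reparam (phi : R -> R) (p : cube R n * unit_interval R) :
  (cube R n * unit_interval R)%type := (p.1, clamp (phi (sval p.2))).

Lemma val_unit_continuous :
  continuous (sval : unit_interval R -> R).
Proof. exact: initial_continuous. Qed.

Lemma reparam_continuous (phi : R -> R) :
  continuous phi -> continuous (reparam phi).
Proof.
move=> cphi p.
have cg : continuous (fun s : unit_interval R => clamp (phi (sval s))).
  move=> s.
  have := cvg_comp _ _ (cphi (sval s)) (@clamp_continuous (phi (sval s))).
  exact: (cvg_comp _ _ (@val_unit_continuous s)).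
have c1 : fst @ p --> p.1 by exact: cvg_fst.
have c2 : snd @ p --> p.2 by exact: cvg_snd.
exact: (cvg_pair c1 (cvg_comp _ _ c2 (cg p.2))).
Qed.

Lemma homotopic_sym f g : homotopic f g -> homotopic g f.
Proof.
move=> [H [cH H0 H1 Hb]]; exists (H \o reparam (fun r => 1 - r)); split.
- move=> p; apply: continuous_comp; last exact: cH.
  apply: (@reparam_continuous (fun r => 1 - r)) => r.
  by apply: cvgB; [exact: cvg_cst|exact: cvg_id].
- by move=> t s s0; apply: H1; rewrite clamp_id s0 subr0// ler01 lexx.
- by move=> t s s1; apply: H0; rewrite clamp_id s1 subrr// ler01 lexx.
- by move=> t s bt; exact: Hb.
Qed.

Lemma homotopic_trans g f h : homotopic f g -> homotopic g h -> homotopic f h.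
Proof.
move=> [H [cH H0 H1 Hb]] [K [cK K0 K1 Kb]].
pose HK (p : cube R n * unit_interval R) :=
  if sval p.2 <= 2^-1 then H (reparam (fun r => 2 * r) p)
  else K (reparam (fun r => 2 * r - 1) p).
pose A := [set p : cube R n * unit_interval R | sval p.2 <= 2^-1].
pose B := [set p : cube R n * unit_interval R | 2^-1 <= sval p.2].
have cv : continuous (fun p : cube R n * unit_interval R => sval p.2).
  move=> p; have c2 : snd @ p --> p.2 by exact: cvg_snd.
  exact: (cvg_comp _ _ c2 (@val_unit_continuous p.2)).
have c2 : continuous (fun r : R => 2 * r).
  by move=> r; apply: cvgM; [exact: cvg_cst|exact: cvg_id].
have c21 : continuous (fun r : R => 2 * r - 1).
  by move=> r; apply: cvgB; [exact: c2|exact: cvg_cst].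
have cHr : continuous (H \o reparam (fun r => 2 * r)).
  by move=> p; apply: continuous_comp; [exact: reparam_continuous|exact: cH].
have cKr : continuous (K \o reparam (fun r => 2 * r - 1)).
  by move=> p; apply: continuous_comp; [exact: reparam_continuous|exact: cK].
have half01 : 0 <= 2^-1 :> R by rewrite invr_ge0.
have HKA p : A p -> H (reparam (fun r => 2 * r) p) = HK p.
  by rewrite /A /HK /= => ->.
have HKB p : B p -> K (reparam (fun r => 2 * r - 1) p) = HK p.
  rewrite /B /HK /= => Bp; case: ifPn => // Ap.
  have pE : sval p.2 = 2^-1 by apply/eqP; rewrite eq_le Ap Bp.
  have e1 : sval (clamp (2 * sval p.2)) = 1.
    by rewrite clamp_id pE mulfV// ler01 lexx.
  have e0 : sval (clamp (2 * sval p.2 - 1)) = 0.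
    by rewrite clamp_id pE mulfV// subrr// ler01 lexx.
  by rewrite /reparam H1// K0.
exists HK; split.
- apply/continuous_subspace_setT.
  have -> : setT = A `|` B.
    apply/seteqP; split=> // p _.
    by case: (leP (sval p.2) 2^-1) => [|/ltW]; [left|right].
  apply: withinU_continuous.
  + by move/continuous_closedP: cv => /(_ _ (@closed_le R 2^-1)).
  + by move/continuous_closedP: cv => /(_ _ (@closed_ge R 2^-1)).
  + apply: (@subspace_eq_continuous _ _ _ (H \o reparam (fun r => 2 * r))).
      by move=> p /set_mem; exact: HKA.
    exact: continuous_subspaceT.
  + apply: (@subspace_eq_continuous _ _ _ (K \o reparam (fun r => 2 * r - 1))).
      by move=> p /set_mem; exact: HKB.
    exact: continuous_subspaceT.
- move=> t s s0; rewrite /HK /= s0 half01 H0// clamp_id s0 mulr0// lexx ler01//.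
- move=> t s s1; rewrite /HK /= s1 leNgt invf_lt1// ltr1n /= K1//.
  have -> : 2 * sval s - 1 = 1 by rewrite s1 mulr1 (_ : 2 = 1 + 1)// addrK.
  by rewrite clamp_id// ler01 lexx.
- by move=> t s bt; rewrite /HK; case: ifP => _; [exact: Hb|exact: Kb].
Qed.

Definition homotopicb f g : bool := `[< homotopic f g >].

Lemma homotopicb_refl : reflexive homotopicb.
Proof. by move=> f; apply/asboolP; exact: homotopic_refl. Qed.

Lemma homotopicb_sym : symmetric homotopicb.
Proof. by move=> f g; apply/asboolP/asboolP; exact: homotopic_sym. Qed.

Lemma homotopicb_trans : transitive homotopicb.
Proof.
move=> g f h /asboolP fg /asboolP gh; apply/asboolP.
exact: homotopic_trans fg gh.
Qed.

End homotopy_equivalence.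

Canonical homotopic_equiv (R : realType) (n : nat) (X : topologicalType)
    (x : X) :=
  EquivRel (@homotopicb R n X x)
    homotopicb_refl homotopicb_sym homotopicb_trans.

Definition homotopy_classes (R : realType) (n : nat) (X : topologicalType)
    (x : X) : quotType (nloop R n x) :=
  {eq_quot (homotopic_equiv R n x)}.

(* Only the topological space underlying the n-th homotopy group is built:
   its points are the homotopy classes and its topology is final for the
   projection \pi from the space of n-loops. *)
Definition pi_top (R : realType) (n : nat) (X : topologicalType) (x : X) :
    topologicalType :=
  quotient_topology (homotopy_classes R n x).

Definition discrete_space (T : topologicalType) : Prop :=
  forall A : set T, open A.

Lemma discrete_spaceP (T : topologicalType) :
  discrete_space T <-> @nbhs T T = principal_filter.
Proof.
split=> [dT|nT A]; last first.
  by rewrite openE => a Aa; rewrite /interior nT; exact/principal_filterP.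
apply/funext => a; apply/seteqP; split=> U.
  by move=> /nbhs_singleton Ua; exact/principal_filterP.
by move=> /principal_filterP Ua; exact: open_nbhs_nbhs.
Qed.

Definition nullhomotopic (R : realType) (n : nat) (X : topologicalType) (x : X)
    (f : nloop R n x) : Prop :=
  homotopic f (cst_nloop R n x).

Definition semilocally_simply_connected (R : realType) (n : nat)
    (X : topologicalType) : Prop :=
  forall x : X, exists U : set X,
    [/\ open U, U x &
        forall f : nloop R n x, range f `<=` U -> nullhomotopic f].

(* Main.v *)
Require Import Defs.
From mathcomp Require Import all_boot all_order all_algebra.
From mathcomp Require Import all_classical all_reals all_analysis.

(** Discreteness makes the trivial class an open point of the quotient, so the
    set of nullhomotopic loops is open in the compact-open topology; it contains
    the constant loop.  Any compact-open neighbourhood of a constant map at [x]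
    contains all maps with values in some neighbourhood [U] of [x]
    ([compact_open_nbhs_cst]): in a finite intersection of subbasic sets
    containing the constant map, each set asks that the image of a compact set
    lie in an open set, which contains [x] as soon as the compact set is
    nonempty, and the intersection of these open sets is such a [U].  Loops in
    [U] are thus nullhomotopic in the whole space. *)

Set Implicit Arguments.
Unset Strict Implicit.
Unset Printing Implicit Defensive.

Import numFieldNormedType.Exports.

Local Open Scope classical_set_scope.
Local Open Scope quotient_scope.

(** The maps with values in small neighbourhoods of [x] generate a filter, and
    the finite intersections of the subbasic description are absorbed by the
    criterion for convergence of this filter to the constant map. *)
Lemma compact_open_nbhs_cst (T X : topologicalType) (x : X)
    (N : set {compact-open, T -> X}) :
  nbhs (cst x : {compact-open, T -> X}) N ->
  exists U : set X,
    [/\ open U, U x & forall g : T -> X, range g `<=` U -> N g].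
Proof.
pose F : set_system {compact-open, T -> X} :=
  filter_from (open_nbhs x) (fun U => [set g | range g `<=` U]).
have FF : Filter F.
  apply: filter_from_filter => [|U V xU xV].
    by exists setT; split => //; exact: openT.
  exists (U `&` V); first exact: open_nbhsI.
  by move=> g gUV; split=> y gy; have [] := gUV _ gy.
have Fx : F --> (cst x : {compact-open, T -> X}).
  apply/compact_open_cvgP => K O _ oO xKO.
  have [[t Kt]|/forallNP K0] := pselect (exists t, K t).
    exists O; first by split=> //; apply: xKO; exists t.
    by move=> g gO; apply: subset_trans gO; exact: image_subset.
  (* the image of an empty set satisfies every constraint *)
  by apply: filterS filterT => g _ y [t /K0].
by move=> /Fx [U [oU Ux] UN]; exists U; split.
Qed.

Lemma eq_pi_top (R : realType) (n : nat) (X : topologicalType) (x : X)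
    (f g : nloop R n x) :
  \pi_(pi_top R n x) f = \pi_(pi_top R n x) g <-> homotopic f g.
Proof.
rewrite -[\pi_(pi_top R n x) f]/(\pi_{eq_quot (homotopic_equiv R n x)} f).
rewrite -[\pi_(pi_top R n x) g]/(\pi_{eq_quot (homotopic_equiv R n x)} g).
by split=> [/eqmodP/asboolP //|fg]; apply/eqmodP/asboolP.
Qed.

Lemma open_nullhomotopic (R : realType) (n : nat) (X : topologicalType) (x : X) :
  discrete_space (pi_top R n x) ->
  open [set f : nloop R n x | nullhomotopic f].
Proof.
move=> /(_ [set \pi_(pi_top R n x) (cst_nloop R n x)]).
(* an open set of the quotient is one whose preimage is open *)
rewrite {1}/open /= /quotient_open => opi.
rewrite (_ : mkset _ = \pi_(pi_top R n x) @^-1`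
  [set \pi_(pi_top R n x) (cst_nloop R n x)]) //.
by apply/seteqP; split=> f /eq_pi_top.
Qed.

Theorem theorem3p2 (R : realType) (n : nat) (X : topologicalType) :
  (0 < n)%N ->
  (forall x : X, discrete_space (pi_top R n x)) ->
  semilocally_simply_connected R n X.
Proof.
move=> _ dpi x.
have [W oW WE] := open_nullhomotopic (dpi x).
have Wx : nbhs (cst x : {compact-open, cube R n -> X}) W.
  apply: open_nbhs_nbhs; split=> //.
  rewrite -[W _]/((@nloop_fun R n X x @^-1` W) (cst_nloop R n x)) WE /=.
  exact: homotopic_refl.
have [U [oU Ux UW]] := compact_open_nbhs_cst Wx.
exists U; split=> // f /UW.
by rewrite -[W _]/((@nloop_fun R n X x @^-1` W) f) WE.
Qed.
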